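(* For a monounary algebra $(A,f)$, the following are equivalent: (1) $A$ is strongly subalgebra separable; (2) $A$ is weakly subalgebra separable; (3) $A$ is residually finite and not bi-eternal; (4) for all $x\in A$, either $x$ is contained in a cycle or there exists $n\in\mathbb{N}$ such that $f^{-n}(x)=\varnothing$.
   Context: $\mathbb{N}$ is the set of non-negative integers. A monounary algebra $(A,f)$ is a (possibly empty) set $A$ with a function $f:A\to A$. A homomorphism $\phi:(A,f_1)\to(B,f_2)$ is a function with $\phi(f_1(a))=f_2(\phi(a))$ for all $a\in A$. A subalgebra of $(A,f)$ is a (possibly empty) subset $S\subseteq A$ with $f(S)\subseteq S$, equipped with $f|_S$. The subalgebra generated by $S\subseteq A$ is $\langle S\rangle=\{f^n(s):n\in\mathbb{N},\,s\in S\}$; a subalgebra is finitely generated if it equals $\langle S\rangle$ for some finite $S$. For $a\in A$ and $n\in\mathbb{N}$, $f^{-n}(a)=\{b\in A: f^n(b)=a\}$ (with $f^0$ the identity). An element $a$ is backwards eternal if $f^{-n}(a)\neq\varnothing$ for all $n\in\mathbb{N}$. A cycle is a subalgebra isomorphic, for some $k\geq 1$, to $C_k=(\{0,\dots,k-1\},x\mapsto x+1 \bmod k)$; thus $a$ is in a cycle iff $f^k(a)=a$ for some $k\ge 1$. $A$ is residually finite if for all distinct $x,y\in A$ there exist a finite monounary algebra $F$ and a homomorphism $\phi:A\to F$ with $\phi(x)\neq\phi(y)$. $A$ is strongly (respectively weakly) subalgebra separable if for any $a\in A$ and any (respectively any finitely generated) subalgebra $B\leq A$ with $a\notin B$, there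 exist a finite monounary algebra $F$ and a homomorphism $\phi:A\to F$ such that $\phi(a)\notin\phi(B)$. $A$ is bi-eternal if there exists $a\in A$ such that (i) for all $i,j\in\mathbb{N}$, $f^i(a)=f^j(a)$ if and only if $i=j$, and (ii) $a$ is backwards eternal. *)

(* Defs.v *)
From mathcomp Require Import all_boot.
From mathcomp Require Import boolp classical_sets functions cardinality.

Set Implicit Arguments.
Unset Strict Implicit.
Unset Printing Implicit Defensive.

Local Open Scope classical_set_scope.

(* A monounary algebra (A, f) is unbundled as a type A, possibly empty, and a
   map f : A -> A; a finite one has its carrier in finType. *)

Definition homomorphism (A B : Type) (f1 : A -> A) (f2 : B -> B)
    (phi : A -> B) : Prop :=
  forall a, phi (f1 a) = f2 (phi a).

Definition subalgebra (A : Type) (f : A -> A) (S : set A) : Prop :=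
  f @` S `<=` S.

Definition generated (A : Type) (f : A -> A) (S : set A) : set A :=
  [set a | exists n s, S s /\ a = iter n f s].

Definition finitely_generated (A : Type) (f : A -> A) (B : set A) : Prop :=
  exists S : set A, finite_set S /\ B = generated f S.

Definition iter_preimage (A : Type) (f : A -> A) (n : nat) (a : A) : set A :=
  iter n f @^-1` [set a].

Definition backwards_eternal (A : Type) (f : A -> A) (a : A) : Prop :=
  forall n, iter_preimage f n a <> set0.

(* C_k is 'I_k with the map ordS, i.e. x |-> x + 1 mod k. *)
Definition is_cycle (A : Type) (f : A -> A) (S : set A) : Prop :=
  subalgebra f S /\
  exists k : nat, (0 < k)%N /\
    exists h : 'I_k -> A,
      homomorphism (@ordS k) f h /\ set_bij [set: 'I_k] S h.

Definition in_cycle (A : Type) (f : A -> A) (a : A) : Prop :=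
  exists S : set A, is_cycle f S /\ S a.

Definition residually_finite (A : Type) (f : A -> A) : Prop :=
  forall x y : A, x <> y ->
    exists (F : finType) (g : F -> F) (phi : A -> F),
      homomorphism f g phi /\ phi x <> phi y.

Definition separable_from (A : Type) (f : A -> A) (a : A) (B : set A) : Prop :=
  exists (F : finType) (g : F -> F) (phi : A -> F),
    homomorphism f g phi /\ ~ (phi @` B) (phi a).

Definition strongly_subalgebra_separable (A : Type) (f : A -> A) : Prop :=
  forall (a : A) (B : set A),
    subalgebra f B -> ~ B a -> separable_from f a B.

Definition weakly_subalgebra_separable (A : Type) (f : A -> A) : Prop :=
  forall (a : A) (B : set A),
    subalgebra f B -> finitely_generated f B -> ~ B a -> separable_from f a B.

Definition bi_eternal (A : Type) (f : A -> A) : Prop :=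
  exists a : A,
    (forall i j : nat, iter i f a = iter j f a <-> i = j) /\
    backwards_eternal f a.

(* Main.v *)
Require Import Defs.
From mathcomp Require Import all_boot.
From mathcomp Require Import boolp classical_sets functions cardinality.

(** Two opposite observations carry the equivalence.

    Obstruction: in a finite algebra the images of the iterates of the map
    shrink to the periodic elements, so every homomorphism to a finite algebra
    sends a backwards eternal element to a periodic one
    ([hom_backwards_eternal]).  A bi-eternal element [a] therefore cannot be
    separated from the subalgebra generated by [f a], and a backwards eternal
    element whose forward orbit falls into a cycle without lying on it cannot
    be separated from a suitable element of that cycle.

    Construction: a predicate [P] on [A] factors through a finite quotient of
    the algebra as soon as two of the predicates [P \o f^n] coincide, for then
    the sequence of truth values of [P] along an orbit is determined by its
    first terms ([finite_recognition]).  If [f^-n(a)] is empty this applies to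
    the singleton of [a], since [f^-n(a)] and [f^-(n+1)(a)] are both empty.  If
    [f^k(a) = a] with [k > 0], it applies to the set of the elements reaching
    [a] after a multiple of [k] steps, which is its own preimage under [f^k].
    Both predicates hold at [a] and fail on every subalgebra that avoids [a],
    which gives strong subalgebra separability; the second one contains no
    other element of the cycle of [a], which separates elements of a common
    cycle.  Elements [x] and [y] that do not share a cycle are separated by
    weak subalgebra separability, because one of them is outside the subalgebra
    generated by the other. *)

Set Implicit Arguments.
Unset Strict Implicit.
Unset Printing Implicit Defensive.

Local Open Scope classical_set_scope.

(** * Iterates and cycles *)

Lemma hom_iter (A B : Type) (f : A -> A) (g : B -> B) (phi : A -> B) :
  homomorphism f g phi ->
  forall n a, phi (iter n f a) = iter n g (phi a).
Proof. by move=> hphi n a; elim: n => //= n IHn; rewrite hphi IHn. Qed.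

Lemma subalgebra_iter (A : Type) (f : A -> A) (B : set A) :
  subalgebra f B -> forall n b, B b -> B (iter n f b).
Proof.
by move=> sB n b Bb; elim: n => //= n IHn; apply: sB; exists (iter n f b).
Qed.

Lemma generated_subalgebra (A : Type) (f : A -> A) (S : set A) :
  subalgebra f (generated f S).
Proof. by move=> _ [_ [n [s [Ss ->]]] <-]; exists n.+1, s. Qed.

Lemma iter_mul_period (A : Type) (f : A -> A) (k : nat) (a : A) :
  iter k f a = a -> forall m, iter (m * k) f a = a.
Proof. by move=> fk; elim=> // m IHm; rewrite mulSn iterD IHm. Qed.

Definition periodic (A : Type) (f : A -> A) (a : A) : Prop :=
  exists2 k, 0 < k & iter k f a = a.

(** The least period is needed from right to left: it is what makes the
    parametrisation of the orbit by the residues injective. *)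
Lemma in_cycleP (A : Type) (f : A -> A) (a : A) :
  in_cycle f a <-> periodic f a.
Proof.
split=> [[S [[_ [k [k0 [h [hh [_ _ surj_h]]]]]] Sa]]|[k0 k0_gt0 fk0]].
  have [i _ <-] := surj_h _ Sa; exists k => //.
  rewrite -(hom_iter hh); congr h; apply: val_inj.
  have valE n : val (iter n (@ordS k) i) = (i + n) %% k.
    elim: n => [|n IHn] /=; first by rewrite addn0 modn_small.
    by rewrite IHn -addn1 modnDml addn1 addnS.
  by rewrite valE modnDr modn_small.
have exk : exists k, (0 < k) && `[< iter k f a = a >].
  by exists k0; rewrite k0_gt0; apply/asboolP.
case: (ex_minnP exk) => k /andP[k_gt0 /asboolP fk] kmin.
have iter_mod n : iter (n %% k) f a = iter n f a.
  by rewrite [in RHS](divn_eq n k) addnC iterD iter_mul_period.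
exists [set iter n f a | n in [set: nat]]; split; last by exists 0.
split; first by move=> _ [_ [n _ <-] <-]; exists n.+1.
exists k; split=> //; exists (fun i : 'I_k => iter i f a); split.
  by move=> i; rewrite /= iter_mod.
split=> [i _|i j _ _ eij|_ [n _ <-]].
- by exists (i : nat).
- apply: val_inj; wlog ltij : i j eij / i < j.
    move=> H; case: (ltngtP i j) => // [ltij|ltji]; first exact: H.
    exact/esym/H.
  (* Running both orbits for [k - j] more steps brings the second one back to
     [a], which makes [k - j + i < k] a period. *)
  have /kmin : (0 < k - j + i) && `[< iter (k - j + i) f a = a >].
    rewrite ltn_addr ?subn_gt0 //=; apply/asboolP.
    by rewrite iterD eij -iterD subnK // ltnW.
  by rewrite -[leqLHS](subnK (ltnW (ltn_ord j))) leq_add2l leqNgt ltij.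
- by exists (Ordinal (ltn_pmod n k_gt0)); last exact: iter_mod.
Qed.

(** * Backwards eternal elements in finite quotients *)

(** Among the [#|F| + 1] first points of an orbit two coincide, so the orbit is
    already periodic after [#|F|] steps. *)
Lemma periodic_iter_card (F : finType) (g : F -> F) (z : F) :
  periodic g (iter #|F| g z).
Proof.
have /injectivePn[i [j neij eij]] : ~~ injectiveb (fun i : 'I_#|F|.+1 => iter i g z).
  by apply/negP => /injectiveP/leq_card; rewrite card_ord ltnn.
wlog ltij : i j neij eij / i < j.
  move=> H; case: (ltngtP i j) => [| |/val_inj eqij]; first exact: H.
    by apply: H; rewrite // eq_sym.
  by rewrite eqij eqxx in neij.
exists (j - i); first by rewrite subn_gt0.
have leiF : i <= #|F| by rewrite -ltnS ltn_ord.
rewrite -iterD addnC.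
have -> : #|F| + (j - i) = #|F| - i + j by rewrite addnBA ?addnBAC // ltnW.
by rewrite iterD -eij -iterD subnK.
Qed.

Lemma hom_backwards_eternal (A : Type) (f : A -> A) (F : finType) (g : F -> F)
    (phi : A -> F) (a : A) :
  homomorphism f g phi -> backwards_eternal f a -> periodic g (phi a).
Proof.
move=> hphi /(_ #|F|) /eqP/set0P[b fb].
by rewrite -fb (hom_iter hphi); apply: periodic_iter_card.
Qed.

(** * Separation by recognizable predicates *)

(** The map sends [b] to the truth values of [P] at [b, f b, ..., f^(j-1) b].
    This word determines that of [f b]: shift it, and fill in the last letter,
    the value of [P] at [f^j b], with the one at [f^i b]. *)
Lemma finite_recognition (A : Type) (f : A -> A) (P : A -> Prop) (i j : nat) :
  i < j -> (forall b, P (iter j f b) <-> P (iter i f b)) ->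
  exists (F : finType) (g : F -> F) (phi : A -> F),
    homomorphism f g phi /\ forall x y, phi x = phi y -> P x -> P y.
Proof.
move=> ltij Pij.
pose F := {ffun 'I_j -> bool}.
pose next (n : 'I_j) : 'I_j := insubd (Ordinal ltij) n.+1.
exists F, (fun u : F => [ffun n => u (next n)]).
exists (fun b => [ffun n : 'I_j => `[< P (iter n f b) >]]).
split=> [b|x y].
  apply/ffunP => n; rewrite !ffunE -iterSr /next val_insubd.
  case: ltnP => // leq_jn; have <- : j = n.+1.
    by apply/eqP; rewrite eqn_leq leq_jn ltn_ord.
  exact/asbool_equiv_eq.
move/ffunP/(_ (Ordinal (leq_ltn_trans (leq0n i) ltij))).
by rewrite !ffunE /= => e Px; apply/asboolP; rewrite -e; apply/asboolP.
Qed.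

Definition reaches_mod (A : Type) (f : A -> A) (k : nat) (a b : A) : Prop :=
  exists m, iter (m * k) f b = a.

Lemma reaches_mod_refl (A : Type) (f : A -> A) (k : nat) (a : A) :
  reaches_mod f k a a.
Proof. by exists 0. Qed.

(** Periodicity of [a] matters only for [b = a], which must return to [a] after
    a nonzero number of steps. *)
Lemma reaches_mod_shift (A : Type) (f : A -> A) (k : nat) (a b : A) :
  iter k f a = a -> reaches_mod f k a (iter k f b) <-> reaches_mod f k a b.
Proof.
move=> fk; split=> [[m <-]|[[|m]]]; first by exists m.+1; rewrite mulSn addnC iterD.
  by move=> /= ->; exists 0.
by rewrite mulSn addnC iterD; exists m.
Qed.

Lemma separate_periodic (A : Type) (f : A -> A) (k : nat) (a : A) :
  0 < k -> iter k f a = a ->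
  exists (F : finType) (g : F -> F) (phi : A -> F),
    homomorphism f g phi /\ forall b, phi a = phi b -> reaches_mod f k a b.
Proof.
move=> k_gt0 fk.
have [F [g [phi [hphi phiP]]]] := @finite_recognition A f (reaches_mod f k a) 0 k
  k_gt0 (fun b => reaches_mod_shift b fk).
by exists F, g, phi; split=> // b /phiP; apply; apply: reaches_mod_refl.
Qed.

Lemma separate_not_eternal (A : Type) (f : A -> A) (n : nat) (a : A) :
  iter_preimage f n a = set0 ->
  exists (F : finType) (g : F -> F) (phi : A -> F),
    homomorphism f g phi /\ forall b, phi a = phi b -> b = a.
Proof.
move=> pre0; have no_pre b : iter n f b <> a.
  by move=> fb; have : iter_preimage f n a b by []; rewrite pre0.
have [b|F [g [phi [hphi phiP]]]] :=
  @finite_recognition A f (fun b => b = a) n n.+1 (ltnSn n).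
  by rewrite iterSr; split=> /no_pre.
by exists F, g, phi; split=> // b /phiP; apply.
Qed.

(** * The implications *)

Lemma strongly_separable_of_cycle_or_not_eternal (A : Type) (f : A -> A) :
  (forall x, in_cycle f x \/ exists n, iter_preimage f n x = set0) ->
  strongly_subalgebra_separable f.
Proof.
move=> H a B sB nBa.
case: (H a) => [/in_cycleP[k k_gt0 fk]|[n pre0]].
  have [F [g [phi [hphi phiP]]]] := separate_periodic k_gt0 fk.
  exists F, g, phi; split=> // -[b Bb /esym/phiP[m fb]].
  by apply: nBa; rewrite -fb; apply: subalgebra_iter.
have [F [g [phi [hphi phiP]]]] := separate_not_eternal pre0.
by exists F, g, phi; split=> // -[b Bb /esym/phiP eba]; apply: nBa; rewrite -eba.
Qed.

Lemma weak_separation_monogenic (A : Type) (f : A -> A) (x y : A) :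
  weakly_subalgebra_separable f -> (forall n, iter n f x <> y) ->
  exists (F : finType) (g : F -> F) (phi : A -> F),
    homomorphism f g phi /\ forall n, phi (iter n f x) <> phi y.
Proof.
move=> W nxy.
have [||F [g [phi [hphi nphi]]]] := W y _ (@generated_subalgebra A f [set x]).
- by exists [set x]; split=> //; apply: finite_set1.
- by move=> [n [_ [-> e]]]; apply: (nxy n).
- exists F, g, phi; split=> // n e; apply: nphi.
  by exists (iter n f x) => //; exists n, x.
Qed.

Lemma weakly_separable_residually_finite (A : Type) (f : A -> A) :
  weakly_subalgebra_separable f -> residually_finite f.
Proof.
move=> W x y nexy.
have [[n fx]|nx] := pselect (exists n, iter n f x = y); last first.
  have [n fx|F [g [phi [hphi nphi]]]] := @weak_separation_monogenic A f x y W.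
    by apply: nx; exists n.
  by exists F, g, phi; split=> //; apply: (nphi 0).
have [[m fy]|ny] := pselect (exists m, iter m f y = x); last first.
  have [m fy|F [g [phi [hphi nphi]]]] := @weak_separation_monogenic A f y x W.
    by apply: ny; exists m.
  by exists F, g, phi; split=> // /esym; apply: (nphi 0).
have n_gt0 : 0 < n by case: n fx nexy => //= ->.
have per_x : iter (m + n) f x = x by rewrite iterD fx.
have per_y : iter (m + n) f y = y by rewrite addnC iterD fy.
have [|F [g [phi [hphi phiP]]]] := separate_periodic _ per_x.
  by rewrite addn_gt0 n_gt0 orbT.
exists F, g, phi; split=> // /phiP[l].
by rewrite iter_mul_period // => /esym.
Qed.

(** A finite quotient makes the image of a bi-eternal [a] periodic, hence equal
    to that of some [f^k(a)] with [k > 0]; yet [a] is outside the subalgebra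
    generated by [f a]. *)
Lemma weakly_separable_not_bi_eternal (A : Type) (f : A -> A) :
  weakly_subalgebra_separable f -> ~ bi_eternal f.
Proof.
move=> W [a [inj_a eternal_a]].
have [n|F [g [phi [hphi nphi]]]] := @weak_separation_monogenic A f (f a) a W.
  by rewrite -iterSr => /(inj_a n.+1 0).
have [[//|k] _ per] := hom_backwards_eternal hphi eternal_a.
by apply: (nphi k); rewrite -iterSr (hom_iter hphi).
Qed.

(** When [f^i(x) = f^j(x)] with [i < j], the point [y] of the orbit at time
    [i * (j - i)] is fixed by every further multiple of that number of steps.
    A finite quotient makes the image of [x] periodic, hence identifies [x]
    with [y]; so residual finiteness puts [x] itself on the cycle. *)
Lemma cycle_or_not_eternal_of_residually_finite (A : Type) (f : A -> A) :
  residually_finite f -> ~ bi_eternal f ->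
  forall x, in_cycle f x \/ exists n, iter_preimage f n x = set0.
Proof.
move=> R nbi x.
have [ex|nex] := pselect (exists n, iter_preimage f n x = set0); first by right.
have eternal_x : backwards_eternal f x by move=> n e; apply: nex; exists n.
left; apply/in_cycleP; apply: contrapT => nper; apply: nbi; exists x; split=> //.
suff inj_lt i j : i < j -> iter i f x <> iter j f x.
  move=> i j; split=> [eij|-> //]; case: (ltngtP i j) => // /inj_lt.
    by case.
  by move/(_ (esym eij)).
move=> ltij eij.
have [i0|i_gt0] := posnP i.
  by apply: nper; exists j; rewrite ?(leq_ltn_trans _ ltij) // -eij i0.
pose k := j - i; pose m := i * k; pose y := iter m f x.
have k_gt0 : 0 < k by rewrite subn_gt0.
have lim : i <= m by rewrite leq_pmulr.
have per_y : iter m f y = y.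
  apply: iter_mul_period; rewrite /y -(subnK lim) iterD -iterD addnC iterD.
  by congr (iter _ f _); rewrite -iterD subnK ?eij // ltnW.
have nexy : x <> y.
  by move=> e; apply: nper; exists m; [rewrite muln_gt0 i_gt0 | rewrite -/y -e].
have [F [g [phi [hphi nphi]]]] := R x y nexy.
have [p p_gt0 per_x] := hom_backwards_eternal hphi eternal_x.
apply: nphi.
(* After [m * p] steps the image of [x] is back at itself, while [x] itself has
   reached [y] after the first [m] steps and returned to it ever since. *)
rewrite -[LHS](iter_mul_period per_x m) -(hom_iter hphi); congr phi.
by rewrite -(prednK p_gt0) mulnS mulnC addnC iterD iter_mul_period.
Qed.

Theorem theorem6p7 (A : Type) (f : A -> A) :
  [<-> strongly_subalgebra_separable f;
       weakly_subalgebra_separable f;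
       residually_finite f /\ ~ bi_eternal f;
       forall x : A,
         in_cycle f x \/ exists n : nat, iter_preimage f n x = set0].
Proof.
tfae.
- by move=> S a B sB _; apply: S.
- move=> W; split; first exact: weakly_separable_residually_finite.
  exact: weakly_separable_not_bi_eternal.
- by case; apply: cycle_or_not_eternal_of_residually_finite.
- exact: strongly_separable_of_cycle_or_not_eternal.
Qed.
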